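(* Let $h\in\mathbb{R}$. If $|r|<\infty$ (that is, $r\in\mathbb{R}$), then Owen's $T$ function $T(h,r)=\frac{1}{2\pi}\int_0^r\frac{e^{-\frac12h^2(1+x^2)}}{1+x^2}\,\mathrm{d}x$ can be written as $$T(h,r)=\frac{\arctan r}{2\pi}-\frac{r}{2\pi(1+r^2)}\sum_{k=0}^\infty\frac{(2k)!!}{(2k+1)!!}\,P(k+1,q)\left(\frac{r^2}{1+r^2}\right)^k$$ $$=\frac{r}{2\pi(1+r^2)}\sum_{k=0}^\infty\frac{(2k)!!}{(2k+1)!!}\,Q(k+1,q)\left(\frac{r^2}{1+r^2}\right)^k$$ $$=U(h,r)-\frac{\arctan\frac1r}{2\pi}+\frac{r}{2\pi(1+r^2)}\sum_{k=0}^\infty\frac{(2k)!!}{(2k+1)!!}\,P(k+1,q)\left(\frac{1}{1+r^2}\right)^k$$ $$=U(h,r)-\frac{r}{2\pi(1+r^2)}\sum_{k=0}^\infty\frac{(2k)!!}{(2k+1)!!}\,Q(k+1,q)\left(\frac{1}{1+r^2}\right)^k,$$ where $q=\frac12(1+r^2)h^2$, $U(h,r)=\frac12(\Phi(h)+\Phi(rh))-\Phi(h)\,\Phi(rh)-\beta$, and $\beta=0$ if $r\ge0$ and $\beta=\frac12$ if $r<0$.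
   Context: $\Phi(x)=\frac{1}{\sqrt{2\pi}}\int_{-\infty}^x e^{-t^2/2}\,\mathrm{d}t$ is the standard normal distribution function. For $a>0$, $x\ge0$, $P(a,x)=\frac{1}{\Gamma(a)}\int_0^x t^{a-1}e^{-t}\,\mathrm{d}t$ and $Q(a,x)=\frac{1}{\Gamma(a)}\int_x^\infty t^{a-1}e^{-t}\,\mathrm{d}t$ are the lower and upper regularized gamma functions. Double factorials: $(2k)!!=2^kk!$ (so $0!!=1$), $(2k+1)!!=1\cdot3\cdots(2k+1)$.
   Formalization: The fourth formula (Q-series in 1/(1+r²)) is asserted only for r ≠ 0, since at r = 0 its series diverges and the expression is 0·∞; in the third formula arctan(1/r) at r = 0, otherwise undefined, is read as π/2. *)

(* Defs.v *)
From Stdlib Require Import Reals Factorial Lia.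
From Coquelicot Require Import Coquelicot.
Open Scope R_scope.

Fixpoint double_fact (n : nat) : nat :=
  match n with
  | S (S m) => n * double_fact m
  | _ => 1
  end.

Lemma double_fact_even (k : nat) : double_fact (2 * k) = (2 ^ k * fact k)%nat.
Proof.
induction k as [|k IH]; [reflexivity|].
replace (2 * S k)%nat with (S (S (2 * k))) by lia.
change (double_fact (S (S (2 * k))))
  with (S (S (2 * k)) * double_fact (2 * k))%nat.
rewrite IH, Nat.pow_succ_r', fact_simpl; lia.
Qed.

Lemma double_fact_odd (k : nat) :
  double_fact (2 * S k + 1) = ((2 * S k + 1) * double_fact (2 * k + 1))%nat.
Proof.
now replace (2 * S k + 1)%nat with (S (S (2 * k + 1))) by lia.
Qed.

Definition std_normal_cdf (x : R) : R :=
  / sqrt (2 * PI) *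
  RInt_gen (fun t => exp (- t ^ 2 / 2)) (Rbar_locally m_infty) (at_point x).

(* For [a < 1] the integrand is singular at [0], and [Rpower] is meaningless
   there for every [a]; approaching all finite endpoints from the right gives
   the intended integrals for all [a > 0] and [x >= 0], including [x = 0]. *)
Definition gamma_integrand (a t : R) : R := Rpower t (a - 1) * exp (- t).

Definition Gamma (a : R) : R :=
  RInt_gen (gamma_integrand a) (at_right 0) (Rbar_locally p_infty).

Definition gammaP (a x : R) : R :=
  / Gamma a * RInt_gen (gamma_integrand a) (at_right 0) (at_right x).

Definition gammaQ (a x : R) : R :=
  / Gamma a * RInt_gen (gamma_integrand a) (at_right x) (Rbar_locally p_infty).

Definition owenT (h r : R) : R :=
  / (2 * PI) *
  RInt (fun x => exp (- (1 / 2) * h ^ 2 * (1 + x ^ 2)) / (1 + x ^ 2)) 0 r.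

Definition owen_beta (r : R) : R := if Rle_dec 0 r then 0 else 1 / 2.

Definition owenU (h r : R) : R :=
  1 / 2 * (std_normal_cdf h + std_normal_cdf (r * h))
  - std_normal_cdf h * std_normal_cdf (r * h) - owen_beta r.

(* arctan (1/r), with the value arctan (+oo) = pi/2 at [r = 0]: the limit from
   the right, matching [owen_beta 0 = 0]. *)
Definition arctan_inv (r : R) : R :=
  if Req_dec_T r 0 then PI / 2 else atan (1 / r).

(* Main.v *)
(** The series in [Q] come from the generating function
    [exp (- q (1 - z)) / (1 - z) = sum_k Q(k+1, q) z^k], the Cauchy product of
    an exponential and a geometric series.  Substituting [x = r s] turns
    [T(h, r)] into [r / (2 pi (1 + r^2))] times the integral over [0 <= s <= 1]
    of the left-hand side at [z = y (1 - s^2)], where [y = r^2 / (1 + r^2) < 1];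
    since [(2k)!! / (2k+1)!!] is the integral of [(1 - s^2)^k], termwise
    integration gives the second formula.  The case [h = 0] is a series for
    [atan r], and [P = 1 - Q] gives the first.

    Replacing [(h, r)] by [(r h, 1 / r)] keeps [q] and the prefactor and turns
    [y] into [1 - y], so the last two formulas amount to Owen's identity
    [T(h, r) + T(r h, 1 / r) = U(h, r)].  With [G x] the integral of
    [exp (- t^2 / 2)] from [0] to [x],
    [T(h, r) + T(r h, 1 / r) + G(h) G(r h) / (2 pi)] has zero derivative in
    [h], hence equals its value at [h = 0]; for [r = 1] and [h -> oo] the same
    identity yields the Gaussian integral. *)
Require Import Defs.
From Stdlib Require Import Reals Factorial Lra Lia.
From Coquelicot Require Import Coquelicot.
Open Scope R_scope.

(** * Poisson sums: derivative, bounds and decay *)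

Lemma exp_le_compat (x y : R) : x <= y -> exp x <= exp y.
Proof. intros [H| ->]; [now apply Rlt_le, exp_increasing|apply Rle_refl]. Qed.

(** The closed form of Q(k+1, x), as [gammaQ_nat] confirms; working with it keeps improper integrals
    out of the series arguments. *)
Definition poisson_cdf (k : nat) (x : R) : R :=
  exp (- x) * sum_f_R0 (fun j => x ^ j / INR (fact j)) k.

Lemma poisson_cdf_S (k : nat) (x : R) :
  poisson_cdf (S k) x =
  poisson_cdf k x + exp (- x) * x ^ S k / INR (fact (S k)).
Proof. unfold poisson_cdf; rewrite tech5; unfold Rdiv; ring. Qed.

(** Telescoping: with p_k = e^(-x) x^k / k!, the derivative of p_(k+1) is p_k - p_(k+1), so only the
    last term survives. *)
Lemma is_derive_poisson_cdf (k : nat) (x : R) :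
  is_derive (poisson_cdf k) x (- (exp (- x) * x ^ k / INR (fact k))).
Proof.
induction k as [|k IH].
- unfold poisson_cdf; simpl sum_f_R0; auto_derive; [easy|]. simpl; field.
- apply is_derive_ext with (fun x => poisson_cdf k x + exp (- x) * x ^ S k / INR (fact (S k))).
  { intro t; now rewrite poisson_cdf_S. }
  replace (- _) with (- (exp (- x) * x ^ k / INR (fact k)) +
     (exp (- x) * x ^ k / INR (fact k) - exp (- x) * x ^ S k / INR (fact (S k)))) by ring.
  apply (is_derive_plus (V := R_NormedModule)); [exact IH|].
  auto_derive; [easy|].
  change (match k with O => 1 | S _ => INR k + 1 end) with (INR (S k)).
  change (fact k + k * fact k)%nat with (fact (S k)).
  rewrite fact_simpl, mult_INR, <- tech_pow_Rmult.
  field; split; [apply INR_fact_neq_0|apply not_0_INR; lia].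
Qed.

Lemma continuous_poisson_cdf (k : nat) (x : R) : continuous (poisson_cdf k) x.
Proof.
apply (ex_derive_continuous (V := R_NormedModule)).
eexists; apply is_derive_poisson_cdf.
Qed.

Lemma poisson_cdf_0 (k : nat) : poisson_cdf k 0 = 1.
Proof.
induction k as [|k IH].
- unfold poisson_cdf; simpl; rewrite Ropp_0, exp_0; field.
- rewrite poisson_cdf_S, IH; simpl; unfold Rdiv; ring.
Qed.

Lemma poisson_cdf_bounds (k : nat) (x : R) :
  0 <= x -> 0 <= poisson_cdf k x <= 1.
Proof.
intro Hx; unfold poisson_cdf; split.
- apply Rmult_le_pos; [apply Rlt_le, exp_pos|].
  apply cond_pos_sum; intro j; apply Rmult_le_pos; [now apply pow_le|].
  apply Rlt_le, Rinv_0_lt_compat, INR_fact_lt_0.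
- replace 1 with (exp (- x) * exp x) by (rewrite <- exp_plus, Rplus_opp_l; apply exp_0).
  apply Rmult_le_compat_l; [apply Rlt_le, exp_pos|now apply exp_ge_taylor].
Qed.

(** Mean value theorem on [0, x], starting from the value 1 at 0. The factorial decay in [k] later
    gives convergence where the geometric factor is 1. *)
Lemma poisson_cdf_compl_le (k : nat) (x : R) :
  0 <= x -> 0 <= 1 - poisson_cdf k x <= x * (x ^ k / INR (fact k)).
Proof.
intro Hx; split; [generalize (poisson_cdf_bounds k x Hx); lra|].
destruct (MVT_gen (poisson_cdf k) 0 x
  (fun t => - (exp (- t) * t ^ k / INR (fact k)))) as [c [Hc H]].
- intros; apply is_derive_poisson_cdf.
- intros t _; apply continuity_pt_filterlim, continuous_poisson_cdf.
- rewrite Rmin_left, Rmax_right in Hc by easy.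
  rewrite poisson_cdf_0 in H.
  replace (1 - poisson_cdf k x) with (x * (exp (- c) * c ^ k / INR (fact k))) by lra.
  apply Rmult_le_compat_l; [easy|].
  apply Rmult_le_compat_r; [apply Rlt_le, Rinv_0_lt_compat, INR_fact_lt_0|].
  rewrite <- (Rmult_1_l (x ^ k)).
  apply Rmult_le_compat; [apply Rlt_le, exp_pos|apply pow_le; lra| |apply pow_incr; lra].
  rewrite <- exp_0; apply exp_le_compat; lra.
Qed.

Lemma poisson_cdf_le_inv (k : nat) (x : R) :
  0 < x -> poisson_cdf k x <= INR (S k) / x.
Proof.
intro Hx.
apply Rmult_le_reg_l with x; [easy|].
replace (x * (INR (S k) / x)) with (INR (S k)) by (field; lra).
(* Termwise, [x * (x^j / j!) = (j+1) * (x^(j+1) / (j+1)!)]. *)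
cut (x * poisson_cdf k x <= INR (S k) * poisson_cdf (S k) x).
{ generalize (poisson_cdf_bounds (S k) x (Rlt_le _ _ Hx)) (pos_INR (S k)); nra. }
induction k as [|k IH].
- unfold poisson_cdf; simpl; generalize (exp_pos (- x)); intro.
  field_simplify; nra.
- rewrite (poisson_cdf_S k), (poisson_cdf_S (S k)), (S_INR (S k)).
  assert (Hp := proj1 (poisson_cdf_bounds (S k) x (Rlt_le _ _ Hx))).
  replace (x * (poisson_cdf k x + exp (- x) * x ^ S k / INR (fact (S k))))
    with (x * poisson_cdf k x
          + (INR (S k) + 1) * (exp (- x) * x ^ S (S k) / INR (fact (S (S k))))).
  + assert (0 <= INR (S k) * (exp (- x) * x ^ S (S k) / INR (fact (S (S k))))).
    { apply Rmult_le_pos; [apply pos_INR|]. apply Rmult_le_pos.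
      - apply Rmult_le_pos; [apply Rlt_le, exp_pos|apply pow_le; lra].
      - apply Rlt_le, Rinv_0_lt_compat, INR_fact_lt_0. }
    lra.
  + rewrite <- S_INR, (fact_simpl (S k)), mult_INR, <- (tech_pow_Rmult x (S k)).
    field; split; [apply INR_fact_neq_0|apply not_0_INR; lia].
Qed.

Lemma is_lim_poisson_cdf_p_infty (k : nat) : is_lim (poisson_cdf k) p_infty 0.
Proof.
apply is_lim_le_le_loc with (fun _ => 0) (fun x => INR (S k) * / x).
- exists 0; intros x Hx; split.
  + apply poisson_cdf_bounds; lra.
  + now apply poisson_cdf_le_inv.
- apply is_lim_const.
- replace (Finite 0) with (Rbar_mult (INR (S k)) 0)
    by (simpl; now rewrite Rmult_0_r).
  apply is_lim_scal_l.
  replace (Finite 0) with (Rbar_inv p_infty) by easy.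
  now apply is_lim_inv; [apply is_lim_id|].
Qed.

(** * Gamma functions at positive integers *)

(** An antiderivative of e^(-x) x^k is [- k! * poisson_cdf k]. Arbitrary filters let one proof serve
    [Gamma], [gammaP] and [gammaQ]; they must force positive endpoints, since [Rpower] agrees with
    the ordinary power only there. *)
Lemma is_RInt_gen_gamma_integrand (k : nat) {Fa Fb : (R -> Prop) -> Prop}
  {FFa : Filter Fa} {FFb : Filter Fb} (la lb : R) :
  Fa (Rlt 0) -> Fb (Rlt 0) ->
  filterlim (poisson_cdf k) Fa (locally la) ->
  filterlim (poisson_cdf k) Fb (locally lb) ->
  is_RInt_gen (gamma_integrand (INR k + 1)) Fa Fb (INR (fact k) * (la - lb)).
Proof.
intros Ha Hb Hla Hlb.
set (F := fun x => - INR (fact k) * poisson_cdf k x).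
assert (HF : forall x, is_derive F x (exp (- x) * x ^ k)).
{ intro x; unfold F.
  replace (exp (- x) * x ^ k)
    with (- INR (fact k) * - (exp (- x) * x ^ k / INR (fact k)))
    by (field; apply INR_fact_neq_0).
  apply is_derive_scal, is_derive_poisson_cdf. }
assert (HlF : forall (G : (R -> Prop) -> Prop) (l : R),
  filterlim (poisson_cdf k) G (locally l) ->
  filterlim F G (locally (- INR (fact k) * l))).
{ intros G l Hl.
  apply (filterlim_comp _ _ _ (poisson_cdf k) (Rmult (- INR (fact k))) G (locally l));
    [exact Hl|].
  apply (filterlim_scal_r (K := R_AbsRing) (V := R_NormedModule)). }
replace (INR (fact k) * (la - lb))
  with (- INR (fact k) * lb - (- INR (fact k) * la)) by ring.
apply is_RInt_gen_ext with (Derive F).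
- exists (Rlt 0) (Rlt 0); [exact Ha|exact Hb|].
  intros a b Hpa Hpb x Hx; simpl in Hx.
  assert (Hx0 : 0 < x) by (generalize (Rmin_glb_lt a b 0 Hpa Hpb); lra).
  rewrite (is_derive_unique _ _ _ (HF x)); unfold gamma_integrand.
  replace (INR k + 1 - 1) with (INR k) by ring.
  rewrite Rpower_pow by easy; apply Rmult_comm.
- apply is_RInt_gen_Derive.
  + exists (Rlt 0) (Rlt 0); [exact Ha|exact Hb|].
    intros a b _ _ x _; eexists; apply HF.
  + exists (Rlt 0) (Rlt 0); [exact Ha|exact Hb|].
    intros a b _ _ x _.
    apply continuous_ext with (fun x => exp (- x) * x ^ k).
    { intro t; symmetry; apply is_derive_unique, HF. }
    apply (ex_derive_continuous (V := R_NormedModule)); now auto_derive.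
  + now apply HlF.
  + now apply HlF.
Qed.

Lemma at_right_pos (x : R) : 0 <= x -> at_right x (Rlt 0).
Proof.
intro Hx; exists (mkposreal 1 Rlt_0_1); intros y _ Hy; lra.
Qed.

Lemma filterlim_poisson_cdf_at_right (k : nat) (x : R) :
  filterlim (poisson_cdf k) (at_right x) (locally (poisson_cdf k x)).
Proof.
eapply filterlim_filter_le_1; [apply filter_le_within|].
apply continuous_poisson_cdf.
Qed.

Lemma Gamma_nat (k : nat) : Gamma (INR k + 1) = INR (fact k).
Proof.
unfold Gamma.
replace (INR (fact k)) with (INR (fact k) * (1 - 0)) by ring.
apply is_RInt_gen_unique,
  (is_RInt_gen_gamma_integrand k (Fa := at_right 0) (Fb := Rbar_locally p_infty)).
- apply at_right_pos; lra.
- now exists 0.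
- rewrite <- (poisson_cdf_0 k); apply filterlim_poisson_cdf_at_right.
- apply is_lim_poisson_cdf_p_infty.
Qed.

Lemma gammaQ_nat (k : nat) (x : R) :
  0 <= x -> gammaQ (INR k + 1) x = poisson_cdf k x.
Proof.
intro Hx; unfold gammaQ; rewrite Gamma_nat.
rewrite (is_RInt_gen_unique _ (INR (fact k) * (poisson_cdf k x - 0))).
- field; apply INR_fact_neq_0.
- apply
    (is_RInt_gen_gamma_integrand k (Fa := at_right x) (Fb := Rbar_locally p_infty)).
  + now apply at_right_pos.
  + now exists 0.
  + apply filterlim_poisson_cdf_at_right.
  + apply is_lim_poisson_cdf_p_infty.
Qed.

Lemma gammaP_nat (k : nat) (x : R) :
  0 <= x -> gammaP (INR k + 1) x = 1 - poisson_cdf k x.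
Proof.
intro Hx; unfold gammaP; rewrite Gamma_nat.
rewrite (is_RInt_gen_unique _ (INR (fact k) * (1 - poisson_cdf k x))).
- field; apply INR_fact_neq_0.
- apply
    (is_RInt_gen_gamma_integrand k (Fa := at_right 0) (Fb := at_right x)).
  + apply at_right_pos; lra.
  + now apply at_right_pos.
  + rewrite <- (poisson_cdf_0 k) at 1; apply filterlim_poisson_cdf_at_right.
  + apply filterlim_poisson_cdf_at_right.
Qed.

(** * Wallis integrals *)

Definition wallis (k : nat) : R :=
  INR (double_fact (2 * k)) / INR (double_fact (2 * k + 1)).

Lemma double_fact_neq_0 (n : nat) : INR (double_fact n) <> 0.
Proof.
(* The recursion descends by two, so the induction carries two consecutive values. *)
cut (double_fact n <> 0%nat /\ double_fact (S n) <> 0%nat).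
{ intros [H _]; now apply not_0_INR. }
induction n as [|n [IH1 IH2]]; [easy|split; [easy|]].
change (S (S n) * double_fact n <> 0)%nat; lia.
Qed.

Lemma wallis_S (k : nat) :
  wallis (S k) = 2 * INR (S k) / (2 * INR (S k) + 1) * wallis k.
Proof.
unfold wallis; rewrite double_fact_odd.
replace (2 * S k)%nat with (S (S (2 * k))) at 1 by lia.
change (double_fact (S (S (2 * k))))
  with (S (S (2 * k)) * double_fact (2 * k))%nat.
replace (S (S (2 * k))) with (2 * S k)%nat by lia.
rewrite !mult_INR, plus_INR, mult_INR.
change (INR 2) with 2; change (INR 1) with 1.
field; split; [apply double_fact_neq_0|].
generalize (pos_INR (S k)); lra.
Qed.

(** Integration by parts: with m = k+1, the function s (1 - s^2)^m vanishes at 0 and 1, and its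
    derivative [d] combines two consecutive integrands. Integrating [d] gives the recurrence of
    [wallis_S]. *)
Lemma is_RInt_wallis (k : nat) :
  is_RInt (fun s => (1 - s ^ 2) ^ k) 0 1 (wallis k).
Proof.
induction k as [|k IH].
- apply is_RInt_ext with (fun _ => 1); [easy|].
  replace (wallis 0) with (scal (1 - 0) 1)
    by (unfold wallis, scal; simpl; unfold mult; simpl; field).
  apply (is_RInt_const (V := R_NormedModule)).
- set (m := INR (S k)).
  assert (Hm : 0 <= m) by apply pos_INR.
  set (d := fun s => (2 * m + 1) * (1 - s ^ 2) ^ S k - 2 * m * (1 - s ^ 2) ^ k).
  assert (Hd : is_RInt d 0 1 0).
  { replace 0 with (minus (1 * (1 - 1 ^ 2) ^ S k) (0 * (1 - 0 ^ 2) ^ S k)) at 2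
      by (unfold minus, plus, opp; simpl; ring).
    apply (is_RInt_derive (fun s => s * (1 - s ^ 2) ^ S k)).
    - intros s _; auto_derive; [easy|].
      change (match k with O => 1 | S _ => INR k + 1 end) with m.
      unfold d; rewrite <- tech_pow_Rmult.
      replace (1 - s ^ 2) with (1 + - (s * (s * 1))) by ring.
      generalize ((1 + - (s * (s * 1))) ^ k); intro; ring.
    - intros s _; apply (ex_derive_continuous (V := R_NormedModule)).
      unfold d; now auto_derive. }
  assert (H := is_RInt_scal _ _ _ (/ (2 * m + 1)) _
    (is_RInt_plus _ _ _ _ _ _ Hd (is_RInt_scal _ _ _ (2 * m) _ IH))).
  rewrite wallis_S; fold m.
  replace (2 * m / (2 * m + 1) * wallis k)
    with (scal (/ (2 * m + 1)) (plus 0 (scal (2 * m) (wallis k)))).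
  + eapply is_RInt_ext; [|exact H].
    intros s _; unfold d, scal, plus; simpl; unfold mult; simpl; field; lra.
  + unfold scal, plus; simpl; unfold mult; simpl; field; lra.
Qed.

Lemma wallis_bounds (k : nat) : 0 <= wallis k <= 1.
Proof.
induction k as [|k IH]; [unfold wallis; simpl; lra|].
rewrite wallis_S.
assert (0 <= 2 * INR (S k) / (2 * INR (S k) + 1) <= 1); [|nra].
assert (H := pos_INR (S k)); split.
- apply Rdiv_le_0_compat; lra.
- apply Rmult_le_reg_r with (2 * INR (S k) + 1); [lra|field_simplify; lra].
Qed.

(** * Generating function and termwise integration *)

(** Each term is e^(-q) times a Cauchy product coefficient of the series of e^(qz) and 1/(1 - z); as
    z >= 0, all terms are nonnegative and [is_series_mult_pos] applies. *)
Lemma is_series_poisson_cdf (q z : R) : 0 <= q -> 0 <= z < 1 ->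
  is_series (fun k => poisson_cdf k q * z ^ k) (exp (- (q * (1 - z))) / (1 - z)).
Proof.
intros Hq Hz.
assert (He : is_series (fun k => (q * z) ^ k / INR (fact k)) (exp (q * z))).
{ apply is_series_ext with (fun k => / INR (fact k) * (q * z) ^ k).
  { intro k; apply Rmult_comm. }
  apply is_pseries_R, is_exp_Reals. }
assert (Hg : is_series (fun k => z ^ k) (/ (1 - z))).
{ apply is_series_geom; rewrite Rabs_pos_eq; lra. }
assert (H := is_series_scal_l (exp (- q)) _ _ (is_series_mult_pos _ _ _ _ He Hg
  (fun k => Rmult_le_pos _ _ (pow_le _ k (Rmult_le_pos _ _ Hq (proj1 Hz)))
    (Rlt_le _ _ (Rinv_0_lt_compat _ (INR_fact_lt_0 k))))
  (fun k => pow_le _ k (proj1 Hz)))).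
replace (exp (- (q * (1 - z))) / (1 - z))
  with (scal (exp (- q)) (exp (q * z) * / (1 - z))).
- eapply is_series_ext; [|exact H].
  intro k; simpl; unfold scal; simpl; unfold mult; simpl; unfold poisson_cdf.
  rewrite Rmult_assoc, (Rmult_comm _ (z ^ k)); f_equal.
  rewrite scal_sum; apply sum_eq; intros j Hj.
  rewrite Rpow_mult_distr; replace (z ^ k) with (z ^ j * z ^ (k - j)).
  + unfold Rdiv; ring.
  + rewrite <- pow_add; f_equal; lia.
- unfold scal; simpl; unfold mult; simpl; unfold Rdiv.
  rewrite <- Rmult_assoc, <- exp_plus; do 2 f_equal; ring.
Qed.

(** The tail is dominated by the geometric tail in [y]. The bound does not depend on [z], so
    convergence is uniform on [0, y]. *)
Lemma series_remainder_geom (u : nat -> R) (l z y : R) (n : nat) :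
  0 <= z <= y -> y < 1 -> (forall k, 0 <= u k <= 1) ->
  is_series (fun k => u k * z ^ k) l ->
  Rabs (sum_n (fun k => u k * z ^ k) n - l) <= y ^ S n / (1 - y).
Proof.
intros Hz Hy Hu Hl.
assert (Ht : is_series (fun k => u (S n + k)%nat * z ^ (S n + k))
  (l - sum_n (fun k => u k * z ^ k) n)).
{ apply (is_series_incr_n (fun k => u k * z ^ k) (S n)); [lia|].
  simpl pred.
  replace (plus _ _) with l; [exact Hl|].
  set (A := sum_n (fun k => u k * z ^ k) n : R).
  change (l = l - A + A); ring. }
assert (Hg : is_series (fun k => y ^ S n * y ^ k) (y ^ S n * / (1 - y))).
{ apply (is_series_scal_l (K := R_AbsRing) (V := R_NormedModule)), is_series_geom.
  rewrite Rabs_pos_eq; lra. }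
rewrite <- Rabs_Ropp, Ropp_minus_distr, <- (is_series_unique _ _ Ht).
assert (H0 : forall k, 0 <= u (S n + k)%nat * z ^ (S n + k) <= y ^ S n * y ^ k).
{ intro k; rewrite <- pow_add; split.
  - apply Rmult_le_pos; [apply Hu|apply pow_le; lra].
  - rewrite <- (Rmult_1_l (y ^ _)).
    apply Rmult_le_compat; [apply Hu|apply pow_le; lra|apply Hu|now apply pow_incr]. }
assert (Ha : forall k, Rabs (u (S n + k)%nat * z ^ (S n + k)) =
  u (S n + k)%nat * z ^ (S n + k)).
{ intro k; apply Rabs_pos_eq, H0. }
unfold Rdiv; rewrite <- (is_series_unique _ _ Hg).
eapply Rle_trans; [apply Series_Rabs|].
- eapply ex_series_ext; [intro k; symmetry; apply Ha|eexists; exact Ht].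
- eapply Rle_trans; [apply Req_le, Series_ext, Ha|].
  apply Series_le; [exact H0|eexists; exact Hg].
Qed.

(** For s in [0, 1], z = y (1 - s^2) stays in [0, y], so the partial sums [S_] converge uniformly to
    [g]. Their integrals are the partial sums of the series, by [is_RInt_wallis]. *)
Lemma is_series_wallis_poisson (q y : R) : 0 <= q -> 0 <= y < 1 ->
  is_series (fun k => wallis k * poisson_cdf k q * y ^ k)
    (RInt (fun s => exp (- (q * (1 - y * (1 - s ^ 2))))
                    / (1 - y * (1 - s ^ 2))) 0 1).
Proof.
intros Hq Hy.
set (g := fun s => exp (- (q * (1 - y * (1 - s ^ 2)))) / (1 - y * (1 - s ^ 2))).
set (S_ := fun n s => sum_n (fun k => poisson_cdf k q * (y * (1 - s ^ 2)) ^ k) n).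
assert (Hz : forall s, 0 <= s <= 1 -> 0 <= y * (1 - s ^ 2) <= y).
{ intros s Hs; assert (0 <= 1 - s ^ 2 <= 1) by nra; nra. }
assert (Hg : is_RInt g 0 1 (RInt g 0 1)).
{ apply (RInt_correct (V := R_CompleteNormedModule)).
  apply (ex_RInt_continuous (V := R_CompleteNormedModule)).
  rewrite Rmin_left, Rmax_right by lra; intros s Hs.
  apply (ex_derive_continuous (V := R_NormedModule)); unfold g; auto_derive.
  specialize (Hz s Hs); simpl in Hz; lra. }
assert (HS : forall n, is_RInt (S_ n) 0 1
  (sum_n (fun k => wallis k * poisson_cdf k q * y ^ k) n)).
{ assert (H1 : forall k, is_RInt
    (fun s => poisson_cdf k q * (y * (1 - s ^ 2)) ^ k) 0 1
    (wallis k * poisson_cdf k q * y ^ k)).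
  { intro k.
    replace (wallis k * poisson_cdf k q * y ^ k)
      with (scal (poisson_cdf k q * y ^ k) (wallis k))
      by (unfold scal; simpl; unfold mult; simpl; ring).
    eapply is_RInt_ext; [|apply (is_RInt_scal (V := R_NormedModule)), is_RInt_wallis].
    intros s _; unfold scal; simpl; unfold mult; simpl.
    rewrite Rpow_mult_distr; ring. }
  induction n as [|n IH].
  - rewrite sum_O; eapply is_RInt_ext; [|apply H1].
    intros s _; unfold S_; now rewrite sum_O.
  - rewrite sum_Sn; eapply is_RInt_ext;
      [|apply (is_RInt_plus (V := R_NormedModule)); [exact IH|apply H1]].
    intros s _; unfold S_; now rewrite sum_Sn. }
assert (Hb : forall n,
  Rabs (sum_n (fun k => wallis k * poisson_cdf k q * y ^ k) n - RInt g 0 1)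
  <= y ^ S n / (1 - y)).
{ intro n.
  (* The factor 1 - 0 is the length of the interval of integration. *)
  replace (y ^ S n / (1 - y)) with ((1 - 0) * (y ^ S n / (1 - y))) by ring.
  apply (norm_RInt_le_const (V := R_NormedModule) (fun s => minus (S_ n s) (g s)) 0 1).
  - lra.
  - intros s Hs.
    apply (series_remainder_geom (fun k => poisson_cdf k q)).
    + now apply Hz.
    + apply Hy.
    + intro k; now apply poisson_cdf_bounds.
    + apply is_series_poisson_cdf; [exact Hq|specialize (Hz s Hs); lra].
  - now apply (is_RInt_minus (V := R_NormedModule)). }
assert (Hlim : is_lim_seq (fun n => y ^ S n / (1 - y)) 0).
{ replace (Finite 0) with (Rbar_mult 0 (/ (1 - y))) by (simpl; now rewrite Rmult_0_l).
  apply is_lim_seq_scal_r, (is_lim_seq_incr_1 (fun n => y ^ n)).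
  apply is_lim_seq_geom; rewrite Rabs_pos_eq; lra. }
apply (is_lim_seq_ext (fun n =>
  (sum_n (fun k => wallis k * poisson_cdf k q * y ^ k) n - RInt g 0 1) + RInt g 0 1)
  (sum_n (fun k => wallis k * poisson_cdf k q * y ^ k)) (RInt g 0 1)).
{ intro n; ring. }
replace (Finite (RInt g 0 1)) with (Finite (0 + RInt g 0 1)) by (f_equal; ring).
apply is_lim_seq_plus'; [|apply is_lim_seq_const].
apply is_lim_seq_abs_0.
apply is_lim_seq_le_le with (fun _ => 0) (fun n => y ^ S n / (1 - y)).
- intro n; split; [apply Rabs_pos|apply Hb].
- apply is_lim_seq_const.
- exact Hlim.
Qed.

(** * The Gaussian integral from 0 *)

(** Starting at 0 makes this a proper integral, available before the total Gaussian mass is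
    known. *)
Definition gauss (x : R) : R := RInt (fun t => exp (- t ^ 2 / 2)) 0 x.

Lemma continuous_gauss_density (t : R) : continuous (fun t => exp (- t ^ 2 / 2)) t.
Proof. apply (ex_derive_continuous (V := R_NormedModule)); now auto_derive. Qed.

Lemma ex_RInt_gauss_density (a b : R) : ex_RInt (fun t => exp (- t ^ 2 / 2)) a b.
Proof.
apply (ex_RInt_continuous (V := R_CompleteNormedModule)); intros.
apply continuous_gauss_density.
Qed.

Lemma is_derive_gauss (x : R) : is_derive gauss x (exp (- x ^ 2 / 2)).
Proof.
apply (is_derive_RInt (fun t => exp (- t ^ 2 / 2)) gauss 0 x).
- exists (mkposreal 1 Rlt_0_1); intros y _.
  apply (RInt_correct (V := R_CompleteNormedModule)), ex_RInt_gauss_density.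
- apply continuous_gauss_density.
Qed.

Lemma gauss_0 : gauss 0 = 0.
Proof. apply (RInt_point (V := R_CompleteNormedModule)). Qed.

(** Keeping the factor [u] in the integrand avoids a division, so u = 0 is covered; u = -1 gives
    oddness. *)
Lemma gauss_comp_lin (u x : R) :
  is_RInt (fun t => u * exp (- (u * t) ^ 2 / 2)) 0 x (gauss (u * x)).
Proof.
assert (H : is_RInt (fun t => exp (- t ^ 2 / 2)) (u * 0 + 0) (u * x + 0) (gauss (u * x))).
{ rewrite !Rplus_0_r, Rmult_0_r.
  apply (RInt_correct (V := R_CompleteNormedModule)), ex_RInt_gauss_density. }
eapply is_RInt_ext; [|exact (is_RInt_comp_lin _ _ _ _ _ _ H)].
intros t _; unfold scal; simpl; unfold mult; simpl; now rewrite Rplus_0_r.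
Qed.

Lemma gauss_opp (x : R) : gauss (- x) = - gauss x.
Proof.
replace (- x) with (-1 * x) by ring.
rewrite <- (is_RInt_unique _ _ _ _ (gauss_comp_lin (-1) x)).
apply is_RInt_unique, is_RInt_ext with (fun t => opp (exp (- t ^ 2 / 2))).
- intros t _; replace ((-1 * t) ^ 2) with (t ^ 2) by ring.
  unfold opp; simpl; ring.
- apply (is_RInt_opp (V := R_NormedModule)).
  apply (RInt_correct (V := R_CompleteNormedModule)), ex_RInt_gauss_density.
Qed.

Lemma gauss_nonneg (x : R) : 0 <= x -> 0 <= gauss x.
Proof.
intro Hx; apply RInt_ge_0; [easy|apply ex_RInt_gauss_density|].
intros; apply Rlt_le, exp_pos.
Qed.

(** * Differentiating T in h *)

(** Differentiating under the integral cancels the denominator 1 + x^2 and leaves -h e^(-h^2/2)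
    e^(-(hx)^2/2), which [gauss_comp_lin] integrates. *)
Lemma is_derive_owenT (h r : R) :
  is_derive (fun h => owenT h r) h
    (- (/ (2 * PI) * (exp (- h ^ 2 / 2) * gauss (h * r)))).
Proof.
unfold owenT.
set (f := fun h x => exp (- (1 / 2) * h ^ 2 * (1 + x ^ 2)) / (1 + x ^ 2)).
assert (Hd : forall u x, is_derive (fun h => f h x) u
  (- u * exp (- (1 / 2) * u ^ 2 * (1 + x ^ 2)))).
{ intros u x; unfold f; assert (1 + x ^ 2 <> 0) by nra.
  auto_derive; [easy|]. simpl; field; simpl in *; lra. }
assert (H : is_derive (fun h => RInt (fun x => f h x) 0 r) h
  (RInt (fun x => Derive (fun u => f u x) h) 0 r)).
{ apply is_derive_RInt_param.
  - exists (mkposreal 1 Rlt_0_1); intros u _ x _; eexists; apply Hd.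
  - intros x _.
    apply continuity_2d_pt_ext with
      (fun u x => - u * exp (- (1 / 2) * u ^ 2 * (1 + x ^ 2))).
    { intros u v; symmetry; apply is_derive_unique, Hd. }
    apply continuity_2d_pt_mult.
    + apply continuity_2d_pt_opp, continuity_2d_pt_id1.
    + apply continuity_1d_2d_pt_comp.
      { apply derivable_continuous_pt, derivable_pt_exp. }
      repeat (apply continuity_2d_pt_mult || apply continuity_2d_pt_plus ||
        apply continuity_2d_pt_const || apply continuity_2d_pt_id1 ||
        apply continuity_2d_pt_id2).
  - exists (mkposreal 1 Rlt_0_1); intros u _.
    apply (ex_RInt_continuous (V := R_CompleteNormedModule)); intros x _.
    apply (ex_derive_continuous (V := R_NormedModule)); unfold f.
    auto_derive; nra. }
evar_last; [apply is_derive_scal, H|].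
replace (RInt _ 0 r) with (- (exp (- h ^ 2 / 2) * gauss (h * r))); [ring|].
symmetry; apply is_RInt_unique.
apply is_RInt_ext with
  (fun x => opp (scal (exp (- h ^ 2 / 2)) (h * exp (- (h * x) ^ 2 / 2)))).
- intros x _; etransitivity; [|symmetry; apply is_derive_unique, Hd].
  unfold opp, scal; simpl; unfold mult; simpl.
  replace (- (1 / 2) * (h * (h * 1)) * (1 + x * (x * 1)))
    with (- (h * (h * 1)) / 2 + - (h * x * (h * x * 1)) / 2) by field.
  rewrite exp_plus; ring.
- apply (is_RInt_opp (V := R_NormedModule)),
    (is_RInt_scal (V := R_NormedModule)), gauss_comp_lin.
Qed.

Lemma owenT_0_l (r : R) : owenT 0 r = atan r / (2 * PI).
Proof.
unfold owenT, Rdiv at 3; rewrite Rmult_comm; f_equal.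
apply is_RInt_unique.
replace (atan r) with (minus (atan r) (atan 0))
  by (rewrite atan_0; unfold minus, plus, opp; simpl; ring).
apply is_RInt_ext with (fun x => / (1 + x ^ 2)).
{ intros x _; replace (- (1 / 2) * 0 ^ 2 * (1 + x ^ 2)) with 0 by (simpl; ring).
  rewrite exp_0; symmetry; apply Rmult_1_l. }
apply (is_RInt_derive atan).
- intros x _; apply is_derive_Reals, derivable_pt_lim_atan.
- intros x _; apply (ex_derive_continuous (V := R_NormedModule)).
  auto_derive; nra.
Qed.

(** The derivatives of the two T terms are minus the two halves of the product rule for G(h) G(rh) /
    (2 pi). At h = 0 only the arctangents remain. *)
Lemma owenT_add_gauss (h r : R) : r <> 0 ->
  owenT h r + owenT (r * h) (/ r) + gauss h * gauss (r * h) / (2 * PI) =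
  (atan r + atan (/ r)) / (2 * PI).
Proof.
intro Hr.
set (F := fun h => owenT h r + owenT (r * h) (/ r)
                   + gauss h * gauss (r * h) / (2 * PI)).
assert (HF : forall t : R, is_derive F t 0).
{ intro t; unfold F; evar_last.
  - apply (is_derive_plus (V := R_NormedModule)).
    + apply (is_derive_plus (V := R_NormedModule)); [apply is_derive_owenT|].
      apply (is_derive_comp (fun h => owenT h (/ r)) (fun h => r * h));
        [apply is_derive_owenT|].
      apply (is_derive_scal (fun h => h)), (is_derive_id (K := R_AbsRing)).
    + unfold Rdiv; apply (is_derive_scal_l (K := R_AbsRing) (V := R_NormedModule)).
      apply (is_derive_mult (K := R_AbsRing)).
      * apply is_derive_gauss.
      * apply (is_derive_comp gauss (fun h => r * h)); [apply is_derive_gauss|].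
        apply (is_derive_scal (fun h => h)), (is_derive_id (K := R_AbsRing)).
      * apply Rmult_comm.
  - unfold plus, scal, one; simpl; unfold mult; simpl.
    match goal with |- ?a = ?b => change (@eq R a b) end.
    (* This is the argument of [gauss] in the derivative of the second T term. *)
    replace (r * t * / r) with t by (field; easy).
    rewrite (Rmult_comm t r); ring. }
assert (HFc : forall t, F t = F 0).
{ intro t; destruct (Rtotal_order t 0) as [H|[->|H]]; [|easy|].
  - now apply (eq_is_derive (V := R_NormedModule)).
  - symmetry; now apply (eq_is_derive (V := R_NormedModule)). }
change (F h = (atan r + atan (/ r)) / (2 * PI)).
rewrite HFc; unfold F; rewrite Rmult_0_r, gauss_0, !owenT_0_l.
unfold Rdiv; ring.
Qed.

(** * Total Gaussian mass and the normal distribution function *)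

Lemma is_lim_owenT_1 : is_lim (fun h => owenT h 1) p_infty 0.
Proof.
apply is_lim_le_le_loc with (fun _ => 0) (fun h => / h).
- exists 0; intros h Hh; unfold owenT.
  set (f := fun x => exp (- (1 / 2) * h ^ 2 * (1 + x ^ 2)) / (1 + x ^ 2)).
  assert (Hf : ex_RInt f 0 1).
  { apply (ex_RInt_continuous (V := R_CompleteNormedModule)); intros x _.
    apply (ex_derive_continuous (V := R_NormedModule)); unfold f.
    auto_derive; nra. }
  assert (Hb : forall x, 0 <= f x <= / h).
  { intro x; unfold f; split.
    - apply Rlt_le, Rdiv_lt_0_compat; [apply exp_pos|nra].
    - apply Rle_trans with (exp (- (h ^ 2 / 2)) / 1).
      + apply Rmult_le_compat; [apply Rlt_le, exp_pos| | |].
        * apply Rlt_le, Rinv_0_lt_compat; nra.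
        * apply exp_le_compat; nra.
        * apply Rinv_le_contravar; nra.
      + unfold Rdiv; rewrite Rinv_1, Rmult_1_r, exp_Ropp.
        apply Rinv_le_contravar; [easy|].
        (* The chain e^(h^2/2) >= 1 + h^2/2 >= h bounds the integrand by 1/h. *)
        apply Rle_trans with (1 + h ^ 2 * / 2); [nra|apply exp_ineq1_le]. }
  assert (0 <= RInt f 0 1 <= / h).
  { split.
    - apply RInt_ge_0; [lra|exact Hf|intros; apply Hb].
    - apply Rle_trans with ((1 - 0) * / h); [|lra].
      eapply Rle_trans; [apply Rle_abs|].
      apply abs_RInt_le_const; [lra|exact Hf|].
      intros t _; rewrite Rabs_pos_eq; apply Hb. }
  assert (0 < / (2 * PI) <= 1); [|nra].
  assert (HPI := PI2_1); split; [apply Rinv_0_lt_compat; lra|].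
  rewrite <- Rinv_1; apply Rinv_le_contravar; lra.
- apply is_lim_const.
- replace (Finite 0) with (Rbar_inv p_infty) by easy.
  now apply is_lim_inv; [apply is_lim_id|].
Qed.

(** At r = 1, [owenT_add_gauss] reads G(h)^2 = pi/2 - 4 pi T(h, 1), and T(h, 1) tends to 0.
    Nonnegativity of G for h >= 0 selects the root. *)
Lemma is_lim_gauss_p_infty : is_lim gauss p_infty (sqrt (PI / 2)).
Proof.
apply (is_lim_ext_loc (fun h => sqrt (PI / 2 - 4 * PI * owenT h 1))).
{ exists 0; intros h Hh; rewrite <- (sqrt_Rsqr (gauss h)) by (apply gauss_nonneg; lra).
  f_equal; unfold Rsqr.
  assert (H := owenT_add_gauss h 1 R1_neq_R0).
  rewrite Rinv_1, Rmult_1_l, atan_1 in H.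
  assert (HPI := PI_RGT_0).
  apply (f_equal (Rmult (2 * PI))) in H; field_simplify in H; [|lra|lra]. lra. }
apply (filterlim_comp _ _ _ (fun h => PI / 2 - 4 * PI * owenT h 1) sqrt _ (locally (PI / 2))).
- apply (is_lim_ext (fun h => PI / 2 + (- (4 * PI)) * owenT h 1) _ p_infty (PI / 2)).
  { intro h; ring. }
  replace (Finite (PI / 2)) with (Finite (PI / 2 + (- (4 * PI)) * 0)) by (f_equal; ring).
  apply is_lim_plus'; [apply is_lim_const|].
  apply (is_lim_scal_l (fun h => owenT h 1) _ p_infty 0), is_lim_owenT_1.
- apply continuity_pt_filterlim, continuity_pt_sqrt.
  generalize PI_RGT_0; lra.
Qed.

Lemma is_lim_gauss_m_infty : is_lim gauss m_infty (- sqrt (PI / 2)).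
Proof.
apply (is_lim_ext (fun x => - gauss (- x))).
{ intro x; rewrite gauss_opp; ring. }
apply (is_lim_opp (fun x => gauss (- x)) m_infty (sqrt (PI / 2))).
apply (filterlim_comp _ _ _ Ropp gauss _ (Rbar_locally' p_infty)).
- apply (filterlim_Rbar_opp m_infty).
- apply is_lim_gauss_p_infty.
Qed.

Lemma std_normal_cdf_gauss (x : R) :
  std_normal_cdf x = 1 / 2 + gauss x / sqrt (2 * PI).
Proof.
assert (HPI := PI_RGT_0).
unfold std_normal_cdf.
rewrite (is_RInt_gen_unique _ (gauss x - (- sqrt (PI / 2)))).
(* Thus sqrt(2 pi) = 2 sqrt(pi/2), and the mass of the negative half-line becomes 1/2. *)
- replace (2 * PI) with (4 * (PI / 2)) by field.
  rewrite sqrt_mult by lra; replace (sqrt 4) with 2.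
  + assert (0 < sqrt (PI / 2)) by (apply sqrt_lt_R0; lra). field; lra.
  + symmetry; replace 4 with (2 * 2) by ring; apply sqrt_square; lra.
- assert (HD : forall t, Derive gauss t = exp (- t ^ 2 / 2)).
  { intro t; apply is_derive_unique, is_derive_gauss. }
  apply is_RInt_gen_ext with (Derive gauss).
  { apply filter_forall; intros ab t _; apply HD. }
  apply is_RInt_gen_Derive.
  + apply filter_forall; intros ab t _; eexists; apply is_derive_gauss.
  + apply filter_forall; intros ab t _.
    eapply continuous_ext; [intro; symmetry; apply HD|apply continuous_gauss_density].
  + apply is_lim_gauss_m_infty.
  + intros P HP; exact (locally_singleton (gauss x) P HP).
Qed.

(** * Owen's identity *)

(** The sum is pi/2 for r > 0 and -pi/2 for r < 0; this jump is the origin of beta. *)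
Lemma atan_add_atan_inv (r : R) : r <> 0 ->
  atan r + atan (/ r) = PI / 2 - PI * owen_beta r * 2.
Proof.
intro Hr; unfold owen_beta; destruct (Rle_dec 0 r) as [H|H].
- rewrite atan_inv by lra; ring.
- assert (H' := atan_inv (- r) ltac:(lra)).
  rewrite Rinv_opp, !atan_opp in H'; lra.
Qed.

(** Writing each Phi as 1/2 + G / sqrt(2 pi), the linear terms of U cancel and U = 1/4 - beta - G(h)
    G(rh) / (2 pi). *)
Lemma owenT_add (h r : R) : r <> 0 ->
  owenT h r + owenT (r * h) (/ r) = owenU h r.
Proof.
intro Hr; unfold owenU; rewrite !std_normal_cdf_gauss.
assert (H := owenT_add_gauss h r Hr).
rewrite atan_add_atan_inv in H by easy.
assert (HPI := PI_RGT_0).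
assert (Hs : gauss h / sqrt (2 * PI) * (gauss (r * h) / sqrt (2 * PI))
             = gauss h * gauss (r * h) / (2 * PI)).
{ rewrite <- (sqrt_sqrt (2 * PI)) at 3 by lra.
  field; apply Rgt_not_eq, sqrt_lt_R0; lra. }
replace ((PI / 2 - PI * owen_beta r * 2) / (2 * PI))
  with (1 / 4 - owen_beta r) in H by (field; lra).
lra.
Qed.

(** * Series for T and for the arctangent *)

Lemma owenT_series (h r : R) : exists V : R,
  is_series (fun k => wallis k * poisson_cdf k (1 / 2 * (1 + r ^ 2) * h ^ 2)
                      * (r ^ 2 / (1 + r ^ 2)) ^ k) V /\
  owenT h r = r / (2 * PI * (1 + r ^ 2)) * V.
Proof.
assert (HPI := PI_RGT_0).
assert (Hr : 0 < 1 + r ^ 2) by nra.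
set (q := 1 / 2 * (1 + r ^ 2) * h ^ 2).
set (y := r ^ 2 / (1 + r ^ 2)).
assert (Hq : 0 <= q) by (unfold q; apply Rmult_le_pos; nra).
assert (Hy : 0 <= y < 1).
{ split; [apply Rdiv_le_0_compat; nra|].
  apply Rmult_lt_reg_r with (1 + r ^ 2); [easy|].
  unfold y; field_simplify; nra. }
set (g := fun s => exp (- (q * (1 - y * (1 - s ^ 2)))) / (1 - y * (1 - s ^ 2))).
exists (RInt g 0 1); split; [now apply is_series_wallis_poisson|].
unfold owenT.
set (f := fun x => exp (- (1 / 2) * h ^ 2 * (1 + x ^ 2)) / (1 + x ^ 2)).
assert (Hfc : forall x, continuous f x).
{ intro x; apply (ex_derive_continuous (V := R_NormedModule)); unfold f.
  auto_derive; nra. }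
(* Here 1 - y (1 - s^2) = (1 + (rs)^2) / (1 + r^2), and multiplying by [q] leaves h^2 (1 + (rs)^2) /
   2. The [+ 0] fits the affine form of [RInt_comp_lin]. *)
assert (Hfg : forall s, g s = (1 + r ^ 2) * f (r * s + 0)).
{ intro s; unfold f, g; rewrite Rplus_0_r.
  replace (1 - y * (1 - s ^ 2)) with ((1 + (r * s) ^ 2) / (1 + r ^ 2))
    by (unfold y; field; lra).
  replace (- (q * ((1 + (r * s) ^ 2) / (1 + r ^ 2))))
    with (- (1 / 2) * h ^ 2 * (1 + (r * s) ^ 2)) by (unfold q; field; lra).
  field; split; nra. }
assert (Hg : ex_RInt g 0 1).
{ apply (ex_RInt_continuous (V := R_CompleteNormedModule)); intros s _.
  apply continuous_ext with (fun s => scal (1 + r ^ 2) (f (r * s + 0))).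
  { intro t; now rewrite Hfg. }
  apply (continuous_scal_r (K := R_AbsRing) (V := R_NormedModule)).
  apply (continuous_comp (fun s => r * s + 0) f); [|apply Hfc].
  apply (ex_derive_continuous (V := R_NormedModule)); now auto_derive. }
replace (RInt f 0 r) with (r / (1 + r ^ 2) * RInt g 0 1); [field; lra|].
rewrite <- (RInt_scal (V := R_CompleteNormedModule)) by exact Hg.
rewrite (RInt_ext _ (fun s => scal r (f (r * s + 0)))).
- rewrite (RInt_comp_lin (V := R_CompleteNormedModule)).
  + f_equal; ring.
  + apply (ex_RInt_continuous (V := R_CompleteNormedModule)); intros; apply Hfc.
- intros s _; rewrite Hfg; unfold scal; simpl; unfold mult; simpl; field; simpl in *; lra.
Qed.

(** Euler's arctangent series: at h = 0 also q = 0, and every Poisson factor is 1. *)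
Lemma atan_series (r : R) : exists V : R,
  is_series (fun k => wallis k * (r ^ 2 / (1 + r ^ 2)) ^ k) V /\
  atan r / (2 * PI) = r / (2 * PI * (1 + r ^ 2)) * V.
Proof.
destruct (owenT_series 0 r) as [V [HV H]]; exists V; split.
- eapply is_series_ext; [|exact HV]; intro k; cbv beta.
  replace (1 / 2 * (1 + r ^ 2) * 0 ^ 2) with 0 by ring.
  now rewrite poisson_cdf_0, Rmult_1_r.
- now rewrite <- owenT_0_l.
Qed.

(** This is the third series at r = 0, where its ratio is 1; the exponential series in [q] dominates
    instead of a geometric one. *)
Lemma ex_series_wallis_poisson_compl (q : R) : 0 <= q ->
  ex_series (fun k => wallis k * (1 - poisson_cdf k q)).
Proof.
intro Hq.
apply (ex_series_le (K := R_AbsRing) (V := R_CompleteNormedModule))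
  with (fun k => q * (/ INR (fact k) * q ^ k)).
- intro k; destruct (wallis_bounds k), (poisson_cdf_compl_le k q Hq).
  unfold norm; simpl; unfold abs; simpl.
  rewrite Rabs_pos_eq by now apply Rmult_le_pos.
  rewrite (Rmult_comm (/ _)).
  unfold Rdiv in *; nra.
- apply (ex_series_scal_l (K := R_AbsRing) (V := R_NormedModule)).
  exists (exp q); apply is_pseries_R, is_exp_Reals.
Qed.

Lemma owenU_0_r (h : R) : owenU h 0 = 1 / 4.
Proof.
unfold owenU, owen_beta; rewrite Rmult_0_l, !std_normal_cdf_gauss, gauss_0.
destruct (Rle_dec 0 0) as [_|H]; [lra|now destruct H; apply Rle_refl].
Qed.

(** * The four formulas *)

(** Convergence is asserted separately because [Series] is total. The last formula excludes r = 0: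
    there the ratio is 1, Q(k+1, q) tends to 1 and the coefficients decay only like k^(-1/2), so the
    series diverges. *)
Theorem theorem5 (h r : R) :
  let q := 1 / 2 * (1 + r ^ 2) * h ^ 2 in
  let c := fun k : nat =>
    INR (double_fact (2 * k)) / INR (double_fact (2 * k + 1)) in
  let s1 := fun k : nat =>
    c k * gammaP (INR k + 1) q * (r ^ 2 / (1 + r ^ 2)) ^ k in
  let s2 := fun k : nat =>
    c k * gammaQ (INR k + 1) q * (r ^ 2 / (1 + r ^ 2)) ^ k in
  let s3 := fun k : nat =>
    c k * gammaP (INR k + 1) q * (1 / (1 + r ^ 2)) ^ k in
  let s4 := fun k : nat =>
    c k * gammaQ (INR k + 1) q * (1 / (1 + r ^ 2)) ^ k in
  (ex_series s1 /\
   owenT h r = atan r / (2 * PI) - r / (2 * PI * (1 + r ^ 2)) * Series s1) /\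
  (ex_series s2 /\
   owenT h r = r / (2 * PI * (1 + r ^ 2)) * Series s2) /\
  (ex_series s3 /\
   owenT h r = owenU h r - arctan_inv r / (2 * PI)
               + r / (2 * PI * (1 + r ^ 2)) * Series s3) /\
  (r <> 0 ->
   ex_series s4 /\
   owenT h r = owenU h r - r / (2 * PI * (1 + r ^ 2)) * Series s4).
Proof.
intros q c s1 s2 s3 s4.
assert (HPI := PI_RGT_0).
assert (Hr2 : 0 < 1 + r ^ 2) by nra.
assert (Hq : 0 <= q) by (unfold q; apply Rmult_le_pos; nra).
destruct (owenT_series h r) as [V2 [HV2 HT]].
destruct (atan_series r) as [V0 [HV0 Hat]].
assert (Hs2 : is_series s2 V2).
{ eapply is_series_ext; [|exact HV2].
  intro k; unfold s2; now rewrite gammaQ_nat. }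
assert (Hs1 : is_series s1 (V0 - V2)).
{ eapply is_series_ext;
    [|apply (is_series_minus (K := R_AbsRing) (V := R_NormedModule));
      [exact HV0|exact HV2]].
  intro k; unfold s1; rewrite gammaP_nat by easy.
  change (wallis k * (r ^ 2 / (1 + r ^ 2)) ^ k
    - wallis k * poisson_cdf k q * (r ^ 2 / (1 + r ^ 2)) ^ k
    = wallis k * (1 - poisson_cdf k q) * (r ^ 2 / (1 + r ^ 2)) ^ k).
  ring. }
(* Both series lemmas are applied at (rh, 1/r): [V4] is the sum for T, [W0] the sum for the
   arctangent, and P = 1 - Q makes the third sum [W0 - V4]. *)
assert (H4 : r <> 0 -> exists V4 W0, is_series s4 V4 /\ is_series s3 (W0 - V4) /\
  owenT (r * h) (/ r) = r / (2 * PI * (1 + r ^ 2)) * V4 /\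
  atan (/ r) / (2 * PI) = r / (2 * PI * (1 + r ^ 2)) * W0).
{ intro Hr.
  assert (Hy : (/ r) ^ 2 / (1 + (/ r) ^ 2) = 1 / (1 + r ^ 2))
    by (field; repeat split; nra).
  assert (Hc : / r / (2 * PI * (1 + (/ r) ^ 2)) = r / (2 * PI * (1 + r ^ 2)))
    by (field; repeat split; nra).
  assert (Hq' : 1 / 2 * (1 + (/ r) ^ 2) * (r * h) ^ 2 = q)
    by (unfold q; field; easy).
  destruct (owenT_series (r * h) (/ r)) as [V4 [HV4 HT4]].
  destruct (atan_series (/ r)) as [W0 [HW0 Hat4]].
  rewrite Hc in HT4, Hat4.
  exists V4, W0; repeat split; [| |exact HT4|exact Hat4].
  - eapply is_series_ext; [|exact HV4].
    intro k; cbv beta; unfold s4; now rewrite Hq', Hy, gammaQ_nat.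
  - eapply is_series_ext;
      [|apply (is_series_minus (K := R_AbsRing) (V := R_NormedModule));
        [exact HW0|exact HV4]].
    intro k; unfold s3; rewrite gammaP_nat by easy.
    rewrite Hq', Hy.
    change (wallis k * (1 / (1 + r ^ 2)) ^ k
      - wallis k * poisson_cdf k q * (1 / (1 + r ^ 2)) ^ k
      = wallis k * (1 - poisson_cdf k q) * (1 / (1 + r ^ 2)) ^ k).
    ring. }
repeat split.
- eexists; exact Hs1.
- rewrite (is_series_unique _ _ Hs1), HT, Hat; ring.
- eexists; exact Hs2.
- now rewrite (is_series_unique _ _ Hs2).
- destruct (Req_dec r 0) as [Hr|Hr].
  + eapply ex_series_ext; [|apply (ex_series_wallis_poisson_compl q Hq)].
    intro k; unfold s3; rewrite gammaP_nat by easy.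
    replace (1 / (1 + r ^ 2)) with 1 by (rewrite Hr; field).
    rewrite pow1, Rmult_1_r; easy.
  + destruct (H4 Hr) as [V4 [W0 [_ [H3 _]]]]; eexists; exact H3.
- unfold arctan_inv; destruct (Req_dec_T r 0) as [Hr|Hr].
  (* At r = 0 the prefactor vanishes, and U = 1/4 cancels [arctan_inv 0] / (2 pi) = 1/4. *)
  + rewrite HT, Hr, owenU_0_r; field; lra.
  + destruct (H4 Hr) as [V4 [W0 [_ [H3 [HT4 Hat4]]]]].
    rewrite (is_series_unique _ _ H3), <- owenT_add by easy.
    replace (1 / r) with (/ r) by (field; easy); rewrite Hat4, HT4; ring.
- destruct (H4 H) as [V4 [W0 [Hs4 _]]]; eexists; exact Hs4.
- destruct (H4 H) as [V4 [W0 [Hs4 [_ [HT4 _]]]]].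
  rewrite (is_series_unique _ _ Hs4), <- owenT_add by easy.
  rewrite HT4; ring.
Qed.
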